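(* Let $d\ge1$ and let $Q_d$ be the $d$-dimensional hypercube. The minimum time of a one-way communication graph for universal broadcast on $Q_d$ is $\left\lceil \frac{2(2^d-1)}{d}\right\rceil$. More generally, for $1\le l\le d$, the minimum time of a one-way communication graph for universal broadcast to within distance $l$ on $Q_d$ is $\left\lceil \frac{2N_l}{d}\right\rceil$, where $N_l=\sum_{i=1}^{l}\binom{d}{i}$. In addition, such an optimal communication graph can be chosen so that on odd time steps the edges used can be directed arbitrarily, with each such edge used in the opposite direction on the next time step.
   Context: $Q_d$ has vertex set $\{0,1\}^d$, with $u,v$ adjacent iff they differ in exactly one coordinate; every edge is present in both directions. A task graph is a finite sequence $(e_i)$ of directed edges labeled by positive integer times $t(e_i)$ such that (i) $t(e_i)<t(e_j)$ implies $e_i<e_j$ or $e_i,e_j$ incomparable, and (ii) $t(e_i)=t(e_j)$ implies $i=j$ or $e_i,e_j$ incomparable, where $e_i<e_j$ means there is a directed path in the task graph beginning with $e_i$ and ending with $e_j$; its time is its maximum label. A one-way communication graph is a collection of task graphs in which no two edge occurrences joining the same two vertices (in either direction) carry the same label; its time is the maximum time of its task graphs. A one-way communication graph for universal broadcast to within distance $l$ consists, for each vertex $v$, of a task graph containing a directed path from $v$ to every vertex at Hamming distance between $1$ and $l$ from $v$; for $l=d$ this is universal broadcast.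
   Formalization: The arbitrary-direction and reversal claim is proved only for odd time steps before the final one; when the minimum time is odd, its last step has no next step in which to reverse edges, and for d = l = 2 the directions there are not arbitrary. *)

(* Defs.v *)
From HB Require Import structures.
From mathcomp Require Import all_boot all_order all_algebra.

Set Implicit Arguments.
Unset Strict Implicit.
Unset Printing Implicit Defensive.

Definition vertex (d : nat) : finType := {ffun 'I_d -> bool}.

Definition hamming d (u v : vertex d) : nat := #|[set i | u i != v i]|.

Definition adjacent d (u v : vertex d) : bool := hamming u v == 1.

Record timed_edge (d : nat) :=
  TimedEdge { src : vertex d; dst : vertex d; lbl : nat }.

(* The same directed edge may occur several times in a task graph, so edge
   occurrences are referred to by their position in the sequence. *)
Definition tgraph (d : nat) := seq (timed_edge d).

Definition occ d (G : tgraph d) (i : 'I_(size G)) : timed_edge d :=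
  tnth (in_tuple G) i.

(* [i :: p] is a directed path: consecutive edges are head to tail and no
   vertex is repeated.  A single edge is a path. *)
Definition dipath d (G : tgraph d) (i : 'I_(size G)) (p : seq 'I_(size G)) :
    bool :=
  path (fun j k => dst (occ j) == src (occ k)) i p &&
  uniq (src (occ i) :: [seq dst (occ j) | j <- i :: p]).

Definition before d (G : tgraph d) (i j : 'I_(size G)) : Prop :=
  exists2 p, dipath i p & last i p = j.

Definition incomparable d (G : tgraph d) (i j : 'I_(size G)) : Prop :=
  ~ before i j /\ ~ before j i.

Definition is_task_graph d (G : tgraph d) : Prop :=
  [/\ forall i : 'I_(size G), adjacent (src (occ i)) (dst (occ i)),
      forall i : 'I_(size G), 0 < lbl (occ i),
      forall i j : 'I_(size G), lbl (occ i) < lbl (occ j) ->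
        before i j \/ incomparable i j
    & forall i j : 'I_(size G), lbl (occ i) = lbl (occ j) ->
        i = j \/ incomparable i j].

Definition tg_time d (G : tgraph d) : nat := \max_(e <- G) lbl e.

Definition same_ends d (e f : timed_edge d) : bool :=
  ((src e == src f) && (dst e == dst f)) ||
  ((src e == dst f) && (dst e == src f)).

Definition is_comm_graph d (I : finType) (C : I -> tgraph d) : Prop :=
  (forall x : I, is_task_graph (C x)) /\
  (forall (x y : I) (i : 'I_(size (C x))) (j : 'I_(size (C y))),
     same_ends (occ i) (occ j) -> lbl (occ i) = lbl (occ j) ->
     x = y /\ i = j :> nat).

Definition cg_time d (I : finType) (C : I -> tgraph d) : nat :=
  \max_(x : I) tg_time (C x).

Definition has_dipath d (G : tgraph d) (u v : vertex d) : Prop :=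
  exists (i : 'I_(size G)) (p : seq 'I_(size G)),
    [/\ dipath i p, src (occ i) = u & dst (occ (last i p)) = v].

Definition broadcast_within d (l : nat) (C : vertex d -> tgraph d) : Prop :=
  is_comm_graph C /\
  forall u v : vertex d, 1 <= hamming u v <= l -> has_dipath (C u) u v.

Definition universal_broadcast d (C : vertex d -> tgraph d) : Prop :=
  broadcast_within d C.

Definition is_min_time d (P : (vertex d -> tgraph d) -> Prop) (T : int) : Prop :=
  (exists C, P C /\ Posz (cg_time C) = T) /\
  (forall C, P C -> (T <= Posz (cg_time C))%R).

Definition optimal d (P : (vertex d -> tgraph d) -> Prop)
    (C : vertex d -> tgraph d) : Prop :=
  P C /\ forall C', P C' -> cg_time C <= cg_time C'.

(* The directed edge (u, v) is used at time s. *)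
Definition used_at d (C : vertex d -> tgraph d) (s : nat) (u v : vertex d) :
    Prop :=
  exists (x : vertex d) (i : 'I_(size (C x))),
    [/\ lbl (occ i) = s, src (occ i) = u & dst (occ i) = v].

(* A choice, at every time step, of one direction for every edge of the cube:
   [o s u v] means that the edge uv is directed from u to v at time s. *)
Definition is_orientation d (o : nat -> vertex d -> vertex d -> bool) : Prop :=
  forall s u v, adjacent u v -> o s u v = ~~ o s v u.

(* The odd steps that have a next step are those with s < cg_time C.  When the
   time is odd its last step is unpaired: for d = l = 2 the time is 3, all edges
   are used at all steps, every vertex has indegree 1 at step 3, and hence the
   directions at step 3 are not arbitrary. *)
Definition paired_step d (C : vertex d -> tgraph d) (s : nat) : bool :=
  odd s && (s < cg_time C).

Definition reversed_next d (C : vertex d -> tgraph d) : Prop :=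
  forall s u v, paired_step C s -> used_at C s u v -> used_at C s.+1 v u.

(* C' uses the same edges as C at the odd steps, but directed according to o. *)
Definition redirected d (o : nat -> vertex d -> vertex d -> bool)
    (C C' : vertex d -> tgraph d) : Prop :=
  forall s u v, paired_step C s ->
    (used_at C' s u v <-> (used_at C s u v \/ used_at C s v u) /\ o s u v).

(* Among the communication graphs satisfying P, there is an optimal one in which
   the edges used at odd steps can be directed arbitrarily, each of them being
   used in the opposite direction at the next step. *)
Definition arbitrarily_directable d (P : (vertex d -> tgraph d) -> Prop) : Prop :=
  exists C, [/\ optimal P C, reversed_next C
    & forall o, is_orientation o ->
        exists C', [/\ optimal P C', reversed_next C' & redirected o C C']].

Definition N (d l : nat) : nat := \sum_(1 <= i < l.+1) 'C(d, i).

(* Main.v *)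
Require Import Defs.
From mathcomp Require Import all_boot all_order all_algebra.
From mathcomp Require Import zify.
From Stdlib Require Import Classical_Prop.

(** Lower bound: the tree of a vertex has an edge entering each of the [N]
    vertices it must reach, and a time step offers [d 2^(d-1)] undirected edges
    to the [2^d] trees.

    Upper bound: view vertices as subsets of Z/d and let Z/d act by rotation.
    The ball around the empty set is listed orbit by orbit so that the set in
    position [p] contains [p mod d]: an orbit of length [m] placed at the
    positions [p, ..., p+m-1] consists of the rotations by [p, ..., p+m-1] of a
    set containing 0.  Each block of [d] positions then uses each direction at
    most once, so its translates by all vertices use every directed edge at most
    once, that is, two one-way steps, with an arbitrary direction for each edge
    in the first one.  Parents must lie in earlier blocks.  Deleting an element
    next to a longest run of zeros leaves a set with a unique longest run, hence
    one with a full orbit; listing by weight the sets where some run length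
    occurs once, which fill whole blocks, and then the others achieves this.

    If [0 < 2r <= d] for [r = N mod d], the last [r] sets must share one step.
    They are taken in one suitable orbit, each with two directions, these [2r]
    directions being distinct; orienting cyclically the squares spanned by the
    two directions enters every vertex along exactly one of them. *)

Set Implicit Arguments.
Unset Strict Implicit.
Unset Printing Implicit Defensive.

(** * Rotations and runs of zeros *)

Section Rotation.

Variable n : nat.
Notation d := n.+1.
Implicit Types (u v w : vertex d) (p q k y L : nat).

(** Coordinates are read at natural numbers modulo [d], so that a position in the enumeration also
    names a direction. *)
Definition at_pos w p : bool := w (inZp p).

Lemma inZp_mod p : @inZp n (p %% d) = inZp p.
Proof. by apply: val_inj; rewrite /= modn_mod. Qed.

Lemma eq_inZp p q : (@inZp n p == inZp q) = (p == q %[mod d]).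
Proof. by []. Qed.

Lemma at_posDd w p : at_pos w (p + d) = at_pos w p.
Proof. by rewrite /at_pos -inZp_mod modnDr inZp_mod. Qed.

Lemma eq_at_pos u v : (forall p, at_pos u p = at_pos v p) -> u = v.
Proof. by move=> E; apply/ffunP => i; have := E i; rewrite /at_pos valZpK. Qed.

(** As [d = n.+1], adding [n] amounts to subtracting 1 modulo [d], so the set is shifted up by
    one. *)
Definition turn w : vertex d := [ffun i : 'I_d => w (inZp (i + n))].

Lemma at_turn w p : at_pos (turn w) p.+1 = at_pos w p.
Proof.
rewrite /at_pos ffunE; congr (w _); apply: val_inj => /=.
by rewrite modnDml addSnnS modnDr.
Qed.

Lemma at_iter_turn k w p : at_pos (iter k turn w) (p + k) = at_pos w p.
Proof. by elim: k p => [|k IH] p; rewrite ?addn0 // addnS iterS at_turn. Qed.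

Lemma iter_turn_d w : iter d turn w = w.
Proof. by apply: eq_at_pos => p; rewrite -at_posDd at_iter_turn. Qed.

Lemma turn_inj : injective turn.
Proof. by move=> u v E; apply: eq_at_pos => p; rewrite -[LHS]at_turn E at_turn. Qed.

Definition flip w (c : 'I_d) : vertex d := [ffun i => w i (+) (i == c)].

Lemma flipK c : involutive (flip^~ c).
Proof. by move=> w; apply/ffunP => i; rewrite !ffunE addbK. Qed.

Lemma at_flip w p q :
  at_pos (flip w (inZp p)) q = at_pos w q (+) (q == p %[mod d]).
Proof. by rewrite /at_pos ffunE eq_inZp. Qed.

Lemma flip_iter_turn k w p :
  flip (iter k turn w) (inZp (p + k)) = iter k turn (flip w (inZp p)).
Proof.
(* Modulo [d], [k * n] stands for [-k], so [q' + k] is [q]. *)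
apply: eq_at_pos => q; pose q' := q + k * n.
have Eq u : at_pos u q = at_pos u (q' + k).
  by rewrite /at_pos -[inZp q]inZp_mod -[inZp (q' + k)]inZp_mod /q'
     -addnA -mulnSr addnC modnMDl.
by rewrite !Eq at_flip !at_iter_turn at_flip eqn_modDr.
Qed.

Definition weight w := #|[set i | w i]|.

Lemma weight_turn w : weight (turn w) = weight w.
Proof.
have inj : injective (fun i : 'I_d => inZp (i + n) : 'I_d).
  move=> i j /(congr1 val) /= /eqP; rewrite eqn_modDr !modn_small //.
  by move/eqP/val_inj.
rewrite /weight -[RHS](card_preimset _ inj); congr #|pred_of_set _|.
by apply/setP => i; rewrite !inE ffunE.
Qed.

Lemma weight_iter k w : weight (iter k turn w) = weight w.
Proof. by elim: k => //= k IH; rewrite weight_turn. Qed.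

Lemma weight_flip1 w c : w c -> weight w = (weight (flip w c)).+1.
Proof.
move=> wc; rewrite /weight (cardsD1 c) inE wc add1n; congr (#|pred_of_set _|.+1).
by apply/setP => i; rewrite !inE ffunE; case: eqP => [->|]; rewrite ?wc ?addbF.
Qed.

Lemma weight_flip0 w c : ~~ w c -> weight (flip w c) = (weight w).+1.
Proof.
move=> wc; rewrite (@weight_flip1 (flip w c) c) ?flipK //.
by rewrite ffunE eqxx (negbTE wc).
Qed.

Definition origin : vertex d := [ffun=> false].

Lemma weight_eq0 w : (weight w == 0) = (w == origin).
Proof.
rewrite cards_eq0; apply/eqP/eqP => [E|->]; last first.
  by apply/setP => i; rewrite !inE ffunE.
by apply/ffunP => i; move/setP/(_ i): E; rewrite !inE ffunE.
Qed.

Lemma iter_turn_eq0 k w : (iter k turn w == origin) = (w == origin).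
Proof. by rewrite -!weight_eq0 weight_iter. Qed.

Lemma exists_at w : w != origin -> exists2 p, p < d & at_pos w p.
Proof.
move=> w0; case: (pickP (fun i => w i)) => [i wi|w0'].
  by exists i => //; rewrite /at_pos valZpK.
by case/eqP: w0; apply/ffunP => i; rewrite w0' ffunE.
Qed.

Definition gap w y L := [forall i : 'I_L, ~~ at_pos w (y + i)].

Lemma gapP w y L : reflect (forall i, i < L -> ~~ at_pos w (y + i)) (gap w y L).
Proof.
apply: (iffP forallP) => [H i iL|H i]; last exact: H.
exact: (H (Ordinal iL)).
Qed.

Lemma gap_mod w y z L : y = z %[mod d] -> gap w y L = gap w z L.
Proof.
move=> E; apply: eq_forallb => i; congr (~~ _).
by rewrite /at_pos -inZp_mod -modnDml E modnDml inZp_mod.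
Qed.

Lemma gap_iter_turn k w y L : gap (iter k turn w) (y + k) L = gap w y L.
Proof. by apply: eq_forallb => i; rewrite addnAC at_iter_turn. Qed.

Lemma gap_lt w y L : w != origin -> gap w y L -> L < d.
Proof.
move=> /exists_at[p pd wp] /gapP H; rewrite ltnNge; apply/negP => dL.
pose i := (p + y * n) %% d.
have id : i < L by apply: leq_trans dL; rewrite ltn_pmod.
have := H _ id; rewrite /at_pos -inZp_mod modnDmr.
by rewrite addnCA -mulnS addnC modnMDl inZp_mod [w _]wp.
Qed.

(* A set with a run of zeros whose length occurs at exactly one place has no
   rotational symmetry. *)
Definition marked w :=
  [exists L : 'I_d.+1, exists y : 'I_d, forall z : 'I_d, gap w z L == (z == y)].

Lemma markedP w :
  reflect (exists L y, L <= d /\ forall z, gap w z L = (z == y %[mod d]))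
          (marked w).
Proof.
apply: (iffP existsP) => [[L /existsP[y /forallP H]]|[L [y [Ld H]]]].
  exists L, y; split; first by rewrite -ltnS.
  move=> z; rewrite -(@gap_mod w (z %% d)) ?modn_mod //.
  have := H (inZp z); rewrite /= => /eqP ->.
  by rewrite -val_eqE /= [y %% d]modn_small.
exists (Ordinal (Ld : L < d.+1)); apply/existsP; exists (inZp y).
apply/forallP => z; rewrite /= H -val_eqE /=.
by rewrite [z %% d]modn_small.
Qed.

Lemma marked_turn w : marked (turn w) = marked w.
Proof.
apply/markedP/markedP => -[L [y [Ld H]]].
  exists L, (y + n); split=> // z.
  by rewrite -(gap_iter_turn 1) H -(eqn_modDr n) -addnA modnDr.
exists L, (y + 1); split=> // z.
rewrite -(@gap_mod _ (z + n + 1)); last by rewrite -addnA addn1 modnDr.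
by rewrite (gap_iter_turn 1) H -(eqn_modDr 1) -addnA addn1 modnDr.
Qed.

Lemma marked_iter k w : marked (iter k turn w) = marked w.
Proof. by elim: k => //= k IH; rewrite marked_turn. Qed.

Lemma order_turn_le w : order turn w <= d.
Proof.
rewrite leqNgt; apply/negP => lt_d.
by have := findex_iter lt_d; rewrite iter_turn_d findex0.
Qed.

Lemma order_turn_max w m :
  (forall k, 0 < k < m -> iter k turn w != w) -> m <= order turn w.
Proof.
move=> H; rewrite leqNgt; apply/negP => lt.
have := H (order turn w); rewrite order_gt0 lt iter_order ?eqxx //; last exact: turn_inj.
by move=> /(_ isT).
Qed.

(** A rotation by [k] fixing [w] sends the start [y] of the distinguished run to another start
    [y + k]; uniqueness forces [d] to divide [k]. *)
Lemma order_marked w : marked w -> order turn w = d.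
Proof.
move=> /markedP[L [y [Ld H]]]; apply/eqP; rewrite eqn_leq order_turn_le.
apply: order_turn_max => k /andP[k0 kd]; apply/eqP => E.
have := H (y + k); rewrite -{1}E gap_iter_turn H eqxx.
by rewrite -{2}[y]addn0 eqn_modDl mod0n modn_small // eqn0Ngt k0.
Qed.

(* If [0] is an element of [w] followed by a longest run of zeros, deleting it
   merges two runs of zeros into the only longest one. *)
Lemma exists_marked_parent w : w != origin -> exists k,
  let w0 := iter k turn w in
  at_pos w0 0 /\ (flip w0 (inZp 0) != origin -> marked (flip w0 (inZp 0))).
Proof.
move=> w_neq0.
pose P u L := [exists y : 'I_d, gap u y L].
have maxP u : u != origin -> exists y L, [/\ L < d, gap u y L &
    forall z, ~~ gap u z L.+1].
  move=> u0; have ex : exists L, P u L.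
    by exists 0; apply/existsP; exists ord0; apply/gapP.
  have bd L : P u L -> L <= d by case/existsP=> y /(gap_lt u0)/ltnW.
  case: (ex_maxnP ex bd) => L /existsP[y gy] max; exists y, L.
  split=> //; first exact: gap_lt gy.
  move=> z; apply/negP => gz.
  have /max : P u L.+1 by apply/existsP; exists (inZp z); rewrite /= (@gap_mod _ _ z) ?modn_mod.
  by rewrite ltnn.
have [y [L [Ld gy maxL]]] := maxP _ w_neq0.
(* The rotation by [1 - y], which makes the chosen longest run start at 1. *)
pose k := y * n + 1; exists k => w0.
have g1 : gap w0 1 L.
  rewrite (@gap_mod _ _ (y + k)) ?gap_iter_turn //.
  by rewrite /k addnA -mulnS modnMDl.
have maxL0 z : ~~ gap w0 z L.+1.
  rewrite (@gap_mod _ _ (z + k * n + k)) ?gap_iter_turn //.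
  by rewrite -addnA -mulnSr addnC modnMDl.
have w00 : at_pos w0 0.
  apply/negPn/negP => w00; have /negP[] := maxL0 0.
  by apply/gapP => -[|i] // iL; rewrite add0n -add1n; apply: (gapP _ _ _ g1).
split=> // v_neq0; set v := flip w0 _ in v_neq0 *.
have atv q : at_pos v q = at_pos w0 q && (q != 0 %[mod d]).
  rewrite at_flip; case: eqP => [E|_]; last by rewrite addbF andbT.
  by rewrite /at_pos -inZp_mod E inZp_mod [w0 _]w00.
have gv : gap v 0 L.+1.
  apply/gapP => -[|i] iL; rewrite atv; first by rewrite eqxx andbF.
  by rewrite (negbTE (gapP _ _ _ g1 _ _)).
have [z [M [Md gz maxM]]] := maxP _ v_neq0.
have LM : L.+1 <= M.
  rewrite leqNgt; apply/negP => ML; have /negP[] := maxM 0; apply/gapP=> i iM.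
  by apply: (gapP _ _ _ gv); lia.
(* Since [w0] has no run longer than [L < M], such a run of [v] must cover the deleted element 0. *)
have hit t : gap v t M -> exists2 i, i < M & t + i = 0 %[mod d].
  move=> gt; case: (pickP (fun i : 'I_M => t + i == 0 %[mod d])) => [i /eqP E|none].
    by exists i.
  have /negP[] := maxL0 t; apply/gapP => i iL.
  have iM : i < M by lia.
  have := gapP _ _ _ gt _ iM; rewrite atv.
  by rewrite (none (Ordinal iM)) andbT.
have uniq_start t t' i i' : gap v t M -> gap v t' M -> i < M -> i' < M ->
    t + i = t' + i' %[mod d] -> i <= i'.
  move=> gt gt' iM i'M E; rewrite leqNgt; apply/negP => lt.
  (* the run from [t] continues the one from [t'] one step further *)
  have E' : t' = t + (i - i') %[mod d].
    by apply/eqP; rewrite -(eqn_modDr i') -addnA subnK ?E // ltnW.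
  have /negP[] := maxM t; apply/gapP => j; rewrite ltnS leq_eqVlt => /orP[/eqP->|]; last first.
    exact: (gapP _ _ _ gt).
  have jM : M - (i - i') < M by rewrite ltn_subrL subn_gt0 lt (leq_ltn_trans _ iM).
  have := gapP _ _ _ gt' _ jM.
  rewrite /at_pos -[inZp (t' + _)]inZp_mod -modnDml E' modnDml inZp_mod.
  by rewrite -addnA subnKC // (leq_trans (leq_subr _ _) (ltnW iM)).
apply/markedP; exists M, z; split; first exact: ltnW.
move=> t; apply/idP/idP => [gt|/eqP E]; last by rewrite (gap_mod _ _ E).
have [i iM Ei] := hit _ gt; have [j jM Ej] := hit _ gz.
have Eij : i = j.
  by apply/eqP; rewrite eqn_leq; apply/andP; split;
    [apply: (uniq_start t z)|apply: (uniq_start z t)]; rewrite ?Ei ?Ej.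
by move: Ei; rewrite -Ej -Eij => /eqP; rewrite eqn_modDr.
Qed.

End Rotation.

(** * Listing a rotation-invariant set of vertices *)

Section Schedule.

Variable n : nat.
Notation d := n.+1.
Notation vert := (vertex n.+1).
Implicit Types (u v w : vert) (X : {set vert}) (h : vert -> nat).

(* The vertex [w] in position [h w] of the enumeration is reached in block
   [h w %/ d] along direction [h w %% d], from a vertex of an earlier block. *)
Definition schedule X h : Prop :=
  [/\ {in X &, injective h}, {in X, forall w, h w < #|X|}
    & {in X, forall w, let v := flip w (inZp (h w)) in
        v != origin n -> v \in X /\ h v %/ d < h w %/ d}].

Definition turn_closed X := forall w, (turn w \in X) = (w \in X).

Lemma turn_closed_iter X k w :
  turn_closed X -> (iter k (@turn n) w \in X) = (w \in X).
Proof. by move=> tX; elim: k => //= k IH; rewrite tX. Qed.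

Definition turns w : {set vert} := [set u | fconnect (@turn n) w u].

Lemma mem_turns_iter w k : iter k (@turn n) w \in turns w.
Proof. by rewrite inE fconnect_iter. Qed.

Lemma turnsP w u : reflect (exists k, u = iter k (@turn n) w) (u \in turns w).
Proof.
apply: (iffP idP) => [|[k ->]]; last exact: mem_turns_iter.
by rewrite inE => /iter_findex <-; eexists.
Qed.

Lemma turns_closed w : turn_closed (turns w).
Proof. by move=> u; rewrite !inE -same_fconnect1_r //; apply: turn_inj. Qed.

Lemma turns_iter w k : turns (iter k (@turn n) w) = turns w.
Proof.
apply/setP => u; rewrite !inE; symmetry; apply: same_connect.
  exact/fconnect_sym/turn_inj.
exact: fconnect_iter.
Qed.

Lemma card_turns w : #|turns w| = order (@turn n) w.
Proof. by rewrite cardsE. Qed.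

Lemma weight_turns w u : u \in turns w -> weight u = weight w.
Proof. by case/turnsP=> k ->; rewrite weight_iter. Qed.

Lemma marked_turns w u : u \in turns w -> marked u = marked w.
Proof. by case/turnsP=> k ->; rewrite marked_iter. Qed.

Lemma turn_closedD X Y : turn_closed X -> turn_closed Y -> turn_closed (X :\: Y).
Proof. by move=> cX cY w; rewrite !inE cX cY. Qed.

(* Placing an orbit of length [m] in [m] consecutive positions: position [p] is
   given to the rotation by [p] of [w0], which contains [p %% d]. *)
Lemma schedule_orbit X h w0 :
  schedule X h -> turn_closed X -> w0 \notin X -> at_pos w0 0 ->
  (let v0 := flip w0 (inZp 0) in v0 != origin n ->
     v0 \in X /\ forall k, h (iter k (@turn n) v0) %/ d < #|X| %/ d) ->
  exists h', [/\ schedule (X :|: turns w0) h', {in X, h' =1 h}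
    & {in turns w0, forall u, u = iter (h' u) (@turn n) w0}].
Proof.
move=> [injh hX parX] cX w0X w00 par0; pose m := order (@turn n) w0.
pose x := iter #|X| (@turn n) w0.
pose h' u := if u \in X then h u else #|X| + findex (@turn n) x u.
have tx : turns x = turns w0 by apply: turns_iter.
have mx : order (@turn n) x = m by rewrite -card_turns tx card_turns.
have dis u : u \in turns w0 -> u \notin X.
  by case/turnsP=> k ->; rewrite turn_closed_iter.
have E p : #|X| <= p < #|X| + m -> h' (iter p (@turn n) w0) = p.
  move=> /andP[lep ltp]; rewrite /h' turn_closed_iter // (negbTE w0X).
  rewrite -{1}(subnK lep) iterD -/x findex_iter ?subnKC // mx.
  by rewrite ltn_subLR.
have onX : {in X, h' =1 h} by move=> u uX; rewrite /h' uX.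
have onO u : u \in turns w0 -> exists2 p, #|X| <= p < #|X| + m &
    u = iter p (@turn n) w0.
  rewrite -tx inE => cu; exists (findex (@turn n) x u + #|X|).
    by rewrite leq_addl addnC ltn_add2l -mx findex_max.
  by rewrite iterD -/x iter_findex.
have cardE : #|X :|: turns w0| = #|X| + m.
  rewrite /m -card_turns; apply/eqP; rewrite (leq_card_setU X (turns w0)).
  by rewrite disjoint_sym disjoint_subset; apply/subsetP => u /dis; rewrite inE.
exists h'; split=> //; last by move=> _ /onO[p pm ->]; rewrite E.
split.
- move=> u v /setUP[uX|/onO[p pm ->]] /setUP[vX|/onO[q qm ->]].
  + by rewrite !onX //; apply: injh.
  + rewrite (onX _ uX) E // => Epq; have := hX _ uX.
    by rewrite Epq ltnNge; case/andP: qm => ->.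
  + rewrite (onX _ vX) E // => Epq; have := hX _ vX.
    by rewrite -Epq ltnNge; case/andP: pm => ->.
  + by rewrite !E // => ->.
- move=> u /setUP[uX|/onO[p pm ->]]; rewrite cardE.
    by rewrite onX // (leq_trans (hX _ uX)) ?leq_addr.
  by rewrite E //; case/andP: pm.
move=> u /setUP[uX|/onO[p pm ->]] /=.
  rewrite onX // => /(parX _ uX)[vX lt]; split; first by rewrite inE vX.
  by rewrite onX.
(* The parent of the rotation by [p] of [w0] is the rotation by [p] of [v0], so the hypothesis on
   [v0] serves the whole orbit. *)
rewrite E // -[p in inZp p]add0n flip_iter_turn iter_turn_eq0.
move=> /par0[v0X lt]; split; first by rewrite inE turn_closed_iter // v0X.
rewrite onX ?turn_closed_iter //; apply: leq_trans (lt p) _.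
by rewrite leq_div2r //; case/andP: pm.
Qed.

(** Asking this for marked [v] alone allows any unmarked orbit to be removed from [X]. *)
Definition parent_closed X := {in X, forall w v,
  marked v -> v != origin n -> weight v < weight w -> v \in X}.

Lemma exists_parent X w : parent_closed X -> w \in X -> w != origin n ->
  exists k, let w0 := iter k (@turn n) w in
    let v0 := flip w0 (inZp 0) in
    at_pos w0 0 /\ (v0 != origin n -> [/\ marked v0, v0 \in X & weight v0 < weight w]).
Proof.
move=> pX wX w_neq0; have [k [w00 mk]] := exists_marked_parent w_neq0.
exists k; split=> // v0_neq0.
have lt : weight (flip (iter k (@turn n) w) (inZp 0)) < weight w.
  by rewrite -(weight_iter k w) (weight_flip1 w00).
split=> //; first exact: mk.
by apply: (pX w) => //; apply: mk.
Qed.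

(** Induction on [#|X|], setting aside the orbit to be listed last. The two clauses on marked
    vertices are carried along because they keep these vertices below a multiple of [d], hence in
    blocks earlier than that of any new position. *)
Lemma exists_schedule X :
  turn_closed X -> parent_closed X -> origin n \notin X ->
  exists h, [/\ schedule X h, d %| #|X :&: [set w | marked w]|
    & {in X, forall w, marked w -> h w < #|X :&: [set w | marked w]|}].
Proof.
set M := [set w | marked w].
have [m] := ubnP #|X|; elim: m X => // m IH X; rewrite ltnS => Xm cX pX X0.
have [->|[w1 w1X]] := set_0Vmem X.
  exists (fun=> 0); rewrite set0I cards0; split; first by split=> ? //; rewrite inE.
    by [].
  by move=> w; rewrite inE.
(* Marked orbits come first, by increasing weight. *)
have [w [wX unm maxw]] : exists w, [/\ w \in X, marked w -> X \subset M &
    marked w -> {in X, forall u, weight u <= weight w}].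
  have [XM|/subsetPn[w wX]] := boolP (X \subset M); last first.
    by rewrite inE => nm; exists w; split=> //; rewrite (negbTE nm).
  by case: (arg_maxnP (@weight n) w1X) => w wX mw; exists w; split.
have w_neq0 : w != origin n by apply: contraNneq X0 => <-.
have [k [w00 par]] := exists_parent pX wX w_neq0.
set w0 := iter k _ w in w00 par.
have tw : turns w0 = turns w by apply: turns_iter.
pose X' := X :\: turns w.
have cX' : turn_closed X' by apply: turn_closedD => //; apply: turns_closed.
have w0X' : w0 \notin X' by rewrite inE mem_turns_iter.
have subX : turns w \subset X.
  by apply/subsetP => u /turnsP[j ->]; rewrite turn_closed_iter.
have XE : X' :|: turns w0 = X.
  by rewrite tw setUC -{1}(setIidPr subX) setID.
have cardX : #|X'| + #|turns w| = #|X|.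
  by rewrite -(cardsID (turns w) X) (setIidPr subX) addnC.
have cardO : 0 < #|turns w| by rewrite card_turns order_gt0.
have X'0 : origin n \notin X' by rewrite inE negb_and X0 orbT.
have pX' : parent_closed X'.
  move=> u uX' v mv v0 lt; move: (uX'); rewrite inE => /andP[_ uX].
  rewrite inE (pX u) // andbT; apply/negP => vO.
  have mw : marked w by rewrite -(marked_turns vO).
  by have := maxw mw _ uX; rewrite -(weight_turns vO) leqNgt lt.
have X'm : #|X'| < m.
  by apply: leq_trans Xm; rewrite -cardX -[ltnLHS]addn0 ltn_add2l.
have [h' [sch' dM' hM']] := IH _ X'm cX' pX' X'0.
have X'M : #|X' :&: M| <= #|X'| by rewrite subset_leq_card ?subsetIl.
have par' : flip w0 (inZp 0) != origin n -> flip w0 (inZp 0) \in X' /\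
    forall j, h' (iter j (@turn n) (flip w0 (inZp 0))) %/ d < #|X'| %/ d.
  move=> /par[mv vX lt]; have vX' : flip w0 (inZp 0) \in X'.
    by rewrite inE vX andbT; apply/negP => /weight_turns E; rewrite E ltnn in lt.
  split=> // j; apply: leq_trans (leq_div2r d X'M).
  rewrite ltn_divLR // divnK // hM' ?marked_iter //.
  by rewrite turn_closed_iter.
have [h [sch hX' hO]] := schedule_orbit sch' cX' w0X' w00 par'.
rewrite XE in sch; exists h; split=> //.
- have [mw|nmw] := boolP (marked w).
    rewrite (setIidPl (unm mw)) -cardX card_turns order_marked //.
    rewrite dvdn_addl // -(setIidPl (_ : X' \subset M)) //.
    by apply: subset_trans (unm mw); apply: subsetDl.
  suff -> : X :&: M = X' :&: M by [].
  apply/setP => u; rewrite !inE; case mu: (marked u); rewrite ?andbF // !andbT.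
  by case: (boolP (fconnect _ _ _)) => //= c; rewrite -(@marked_turns w u) ?mu ?inE // in nmw.
move=> u uX mu; have [mw|nmw] := boolP (marked w).
  by rewrite (setIidPl (unm mw)); case: sch => _ + _; apply.
have uX' : u \in X'.
  by rewrite inE uX andbT; apply: contra nmw => /marked_turns <-.
rewrite hX' //; apply: leq_trans (hM' _ uX' mu) _.
by rewrite subset_leq_card // setSI // subsetDl.
Qed.

End Schedule.

(** * The ball *)

Section Ball.

Variable n : nat.
Notation d := n.+1.
Notation vert := (vertex n.+1).

Definition ball l : {set vert} := [set w : vert | 0 < weight w <= l].

Lemma card_weight k : #|[set w : vert | weight w == k]| = 'C(d, k).
Proof.
pose g (A : {set 'I_d}) : vert := [ffun i => i \in A].
have ginj : injective g.
  by move=> A A' /ffunP E; apply/setP => i; have := E i; rewrite !ffunE.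
have gw A : weight (g A) = #|A|.
  by rewrite /weight; apply: eq_card => i; rewrite inE ffunE.
rewrite -[d in 'C(d, k)]card_ord -card_draws -(card_imset _ ginj).
apply: eq_card => w; rewrite inE; apply/idP/imsetP => [wk|[A + ->]].
  exists [set i | w i]; first by rewrite inE -/(weight w).
  by apply/ffunP => i; rewrite ffunE inE.
by rewrite inE gw.
Qed.

Lemma card_ball l : #|ball l| = N d l.
Proof.
rewrite /N; elim: l => [|l IH].
  rewrite big_geq //; apply: eq_card0 => w; rewrite inE lt0n leqn0.
  by case: eqP.
rewrite big_nat_recr //= -IH -card_weight -cardsUI.
rewrite [X in _ = _ + X]eq_card0 ?addn0; last first.
  by move=> w; rewrite !inE; lia.
by apply: eq_card => w; rewrite !inE; lia.
Qed.

Lemma ball_neq0 l w : (w \in ball l) = (w != origin n) && (weight w <= l).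
Proof. by rewrite inE lt0n weight_eq0. Qed.

Lemma ball_turn_closed l : turn_closed (ball l).
Proof. by move=> w; rewrite !inE weight_turn. Qed.

Lemma ball_parent_closed l : parent_closed (ball l).
Proof.
move=> w; rewrite inE => /andP[_ wl] v _ v0 lt; rewrite ball_neq0 v0 /=.
exact: leq_trans (ltnW lt) wl.
Qed.

Lemma origin_notin_ball l : origin n \notin ball l.
Proof. by rewrite ball_neq0 eqxx. Qed.

Lemma card_lt_ord k : k <= d -> #|[set i : 'I_d | i < k]| = k.
Proof.
move=> kd; have inj : injective (widen_ord kd).
  by move=> i j /(congr1 val) /= /val_inj.
rewrite -[RHS]card_ord -(card_imset _ inj).
apply: eq_card => i; rewrite inE; apply/idP/imsetP => [ik|[j _ ->]] /=.
  by exists (Ordinal ik) => //; apply: val_inj.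
exact: (ltn_ord j).
Qed.

Lemma weight_le w : @weight n w <= d.
Proof. by rewrite -[d in _ <= d]card_ord max_card. Qed.

(* The orbit of [s] contains the last vertices to be reached.  Its members are
   not used as intermediate vertices. *)
Lemma exists_last_orbit l r : 2 <= l <= d -> 0 < r -> 2 * r <= d ->
  exists s : vert, exists a, [/\ s \in ball l, r <= order (@turn n) s,
    weight s = l \/ ~~ marked s,
    weight (flip s (inZp a)) <= l & weight (flip s (inZp (a + r))) <= l].
Proof.
move=> /andP[l2 ld] r0 r2; have [cI|cII] := boolP ((l < d) || (r == 1)).
  (* The set [s] consists of [0, ..., l-2] and [m]. It has weight [l] and contains 0 and [r], so
     deleting either one stays within weight [l]. *)
  pose m := maxn r l.-1.
  pose s : vert := [ffun i : 'I_d => (i < l.-1) || (i == m :> nat)].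
  have sE p : p < d -> at_pos s p = (p < l.-1) || (p == m).
    by move=> pd; rewrite /at_pos ffunE /= modn_small.
  have md : m < d by rewrite gtn_max; lia.
  have ws : weight s = l.
    have -> : l = (inord m \notin [set i : 'I_d | i < l.-1]) +
                  #|[set i : 'I_d | i < l.-1]|.
      rewrite inE inordK // card_lt_ord; last by lia.
      by rewrite -leqNgt leq_maxr; lia.
    rewrite -cardsU1 /weight; congr #|pred_of_set _|; apply/setP => i.
    by rewrite !inE ffunE orbC -val_eqE /= inordK.
  have s0 : at_pos s 0 by rewrite sE //; lia.
  have sr : at_pos s r by rewrite sE /m; lia.
  exists s, 0; split.
  - by rewrite inE ws; lia.
  (* A period [k < r] carries [r] to [r + k], which is absent if [l.-1 <= r]. Otherwise [l < d], and
     it carries the absent [n] to the present [k.-1]. *)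
  - apply: order_turn_max => k /andP[k0 kr]; apply/eqP => E.
    have per p : at_pos s (p + k) = at_pos s p by rewrite -{1}E at_iter_turn.
    have [lr|rl] := leqP l.-1 r.
      have := per r; rewrite !sE /m; lia.
    have /(_ n) := per; rewrite [n + k](_ : _ = k.-1 + d); last by lia.
    rewrite at_posDd !sE /m; lia.
  - by left.
  - by rewrite -ws (weight_flip1 s0) leqnSn.
  - by rewrite add0n -ws (weight_flip1 sr) leqnSn.
have Eld : l = d by lia.
have r2' : 2 <= r by lia.
(* Weight [l = d] would give an orbit of size 1. The complement of [{0, 2}] is used instead: here
   [d >= 4], its zero runs of length 1 start at both 0 and 2, and none is longer, so it is
   unmarked. *)
pose s : vert := [ffun i : 'I_d => (i != 0 :> nat) && (i != 2 :> nat)].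
have sE p : at_pos s p = (p %% d != 0) && (p %% d != 2).
  by rewrite /at_pos ffunE.
exists s, 0; split.
- rewrite ball_neq0 Eld weight_le andbT; apply/eqP => s0.
  have := sE 1; rewrite s0 /at_pos ffunE !modn_small //; lia.
- apply: order_turn_max => k /andP[k0 kr]; apply/eqP => E.
  have per p : at_pos s (p + k) = at_pos s p by rewrite -{1}E at_iter_turn.
  have := per 0; have := per 2; rewrite !sE.
  rewrite add0n !modn_small; lia.
- right; apply/markedP => -[[|[|L]] [y [_ H]]].
  + have := H (y + 1); rewrite -{3}[y]addn0 eqn_modDl !modn_small //; last by lia.
    by rewrite (_ : gap s (y + 1) 0) //; apply/gapP.
  + have g0 : gap s 0 1 by apply/gapP => -[|i] //; rewrite sE mod0n.
    have g2 : gap s 2 1.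
      by apply/gapP => -[|i] //; rewrite sE addn0 modn_small //; lia.
    have := H 0; have := H 2; rewrite g0 g2 => /esym/eqP <- /esym/eqP.
    rewrite mod0n modn_small; lia.
  + have g : gap s y L.+2 by rewrite H.
    have := gapP _ _ _ g 0 isT; have := gapP _ _ _ g 1 isT.
    rewrite !sE addn0 -modnDml.
    have : y %% d < d by rewrite ltn_pmod.
    move: (y %% d) => z zd; have [zn|] := leqP z.+2 d.
      by rewrite addn1 modn_small //; lia.
    move=> zn; have -> : z = n by lia.
    rewrite addn1 modnn; lia.
- by rewrite Eld weight_le.
- by rewrite Eld weight_le.
Qed.

Lemma exists_ball_schedule l : exists h, schedule (ball l) h.
Proof.
have [|h [sch _ _]] := exists_schedule (@ball_turn_closed l) (@ball_parent_closed l).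
  exact: origin_notin_ball.
by exists h.
Qed.

(* The last [r] positions being consecutive, the [2r] directions [a + h w] and
   [a + r + h w] are distinct modulo [d]. *)
Lemma exists_ball_schedule_last l r : 2 <= l <= d -> 0 < r -> 2 * r <= d ->
  exists h a, schedule (ball l) h /\
    {in ball l, forall w, #|ball l| - r <= h w ->
      forall c, c = inZp (a + h w) \/ c = inZp (a + r + h w) ->
      flip w c != origin n ->
        flip w c \in ball l /\ h (flip w c) < #|ball l| - r}.
Proof.
move=> ld r0 rd; have [s [a [sB rs smark wa wb]]] := exists_last_orbit ld r0 rd.
have s_neq0 : s != origin n by move: sB; rewrite ball_neq0 => /andP[].
have [k [s00 par]] := exists_parent (@ball_parent_closed l) sB s_neq0.
set s0 := iter k _ s in s00 par.
have ts : turns s0 = turns s by apply: turns_iter.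
pose X := ball l :\: turns s.
have cX : turn_closed X.
  by apply: turn_closedD; [apply: ball_turn_closed|apply: turns_closed].
have mX v : marked v -> v != origin n -> weight v < l -> v \in X.
  move=> mv v0 vl; rewrite inE ball_neq0 v0 (ltnW vl) !andbT.
  apply/negP => vs; case: smark => [sl|].
    by move: vl; rewrite (weight_turns vs) sl ltnn.
  by rewrite -(marked_turns vs) mv.
have pX : parent_closed X.
  move=> w /setDP[]; rewrite ball_neq0 => /andP[_ wl] _ v mv v0 lt.
  by apply: mX => //; apply: leq_trans lt wl.
have X0 : origin n \notin X by rewrite inE negb_and origin_notin_ball orbT.
have [h0 [sch0 dM hM]] := exists_schedule cX pX X0.
have s0X : s0 \notin X by rewrite inE mem_turns_iter.
have sl : weight s <= l by move: sB; rewrite ball_neq0 => /andP[].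
have par0 : flip s0 (inZp 0) != origin n -> flip s0 (inZp 0) \in X /\
    forall j, h0 (iter j (@turn n) (flip s0 (inZp 0))) %/ d < #|X| %/ d.
  move=> v0; have [mv _ lt] := par v0.
  have vX : flip s0 (inZp 0) \in X by apply: mX => //; apply: leq_trans lt sl.
  split=> // j; apply: leq_trans (leq_div2r d _); last first.
    exact: (subset_leq_card (subsetIl X [set w | marked w])).
  by rewrite ltn_divLR // divnK // hM ?marked_iter // turn_closed_iter.
have [h [sch hX hO]] := schedule_orbit sch0 cX s0X s00 par0.
have sub : turns s \subset ball l.
  by apply/subsetP => u /turnsP[j ->]; rewrite turn_closed_iter //; apply: ball_turn_closed.
have XE : X :|: turns s0 = ball l by rewrite ts setUC -{1}(setIidPr sub) setID.
rewrite XE in sch.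
have Xle : #|X| <= #|ball l| - r.
  rewrite -(cardsID (turns s) (ball l)) (setIidPr sub) card_turns.
  by rewrite addnC -addnBA // leq_addr.
(* The shift by [k] accounts for indexing the orbit from [s0 = iter k turn s] instead of [s]. *)
exists h, (a + k); split=> // w wB hw c cE v0.
have wO : w \in turns s0.
  move: wB; rewrite -XE => /setUP[wX|//]; case: sch0 => _ /(_ _ wX) + _.
  by rewrite -hX // ltnNge (leq_trans Xle hw).
have wl : weight w = weight s by rewrite (@weight_turns _ s) // -ts.
suff vX : flip w c \in X.
  split; first by move: vX; rewrite inE => /andP[].
  rewrite hX //; apply: leq_trans Xle.
  by case: sch0 => _ /(_ _ vX).
(* The weight is constant on the orbit, and a flip changes it by one, so the parent lies outside the
   orbit. *)
rewrite inE ball_neq0 v0 /=; apply/andP; split.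
  apply/negP => /weight_turns; rewrite -wl => E.
  have [wc|wc] := boolP (w c).
    by have := weight_flip1 wc; rewrite E => /n_Sn.
  by have := weight_flip0 wc; rewrite E => /n_Sn.
case: cE => ->; move: (hO _ wO); move: (h w) => p ->.
  by rewrite flip_iter_turn weight_iter flip_iter_turn weight_iter.
by rewrite flip_iter_turn weight_iter addnAC flip_iter_turn weight_iter.
Qed.

End Ball.

(** * Translates of a tree *)

Section Translates.

Variable n : nat.
Notation d := n.+1.
Notation vert := (vertex n.+1).
Implicit Types (u v w x : vert).

Definition xorv u v : vert := [ffun i => u i (+) v i].

Lemma xorv0 u : xorv u (origin n) = u.
Proof. by apply/ffunP => i; rewrite !ffunE addbF. Qed.

Lemma xorvv u : xorv u u = origin n.
Proof. by apply/ffunP => i; rewrite !ffunE addbb. Qed.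

Lemma xorKv u : involutive (xorv u).
Proof. by move=> v; apply/ffunP => i; rewrite !ffunE addKb. Qed.

Lemma xorvK u : involutive (xorv^~ u).
Proof. by move=> v; apply/ffunP => i; rewrite !ffunE addbK. Qed.

Lemma flip_xorv u v c : flip (xorv u v) c = xorv u (flip v c).
Proof. by apply/ffunP => i; rewrite !ffunE addbA. Qed.

Lemma hamming_xorv u v : hamming u v = weight (xorv u v).
Proof. by apply: eq_card => i; rewrite !inE ffunE; case: (u i) (v i) => -[]. Qed.

Lemma adjacent_flip u c : adjacent (flip u c) u.
Proof.
rewrite /adjacent hamming_xorv; apply/eqP; rewrite -(cards1 c).
by apply: eq_card => i; rewrite !inE !ffunE addbC addKb.
Qed.

Lemma adjacentP u v : reflect (exists c, u = flip v c) (adjacent u v).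
Proof.
apply: (iffP idP) => [|[c ->]]; last exact: adjacent_flip.
move=> /cards1P[c /setP E]; exists c; apply/ffunP => i.
by have := E i; rewrite !inE ffunE => <-; case: (u i) (v i) => -[].
Qed.

Variables (B : {set vert}) (col : vert -> vert -> 'I_d) (lab : vert -> vert -> nat).

(* In the tree rooted at [v], the vertex [x = xorv v w] is entered along
   direction [col x w] at time [lab x w]. *)
Definition tree_edge v w : timed_edge d :=
  let x := xorv v w in TimedEdge (flip x (col x w)) x (lab x w).

Definition tree v : tgraph d := [seq tree_edge v w | w <- enum B].

Definition offset v (i : 'I_(size (tree v))) : vert := nth (origin n) (enum B) i.

Lemma size_tree v : size (tree v) = size (enum B).
Proof. by rewrite size_map. Qed.

Lemma offset_mem v (i : 'I_(size (tree v))) : offset i \in B.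
Proof. by rewrite -mem_enum mem_nth // -(size_tree v). Qed.

Lemma occ_tree v (i : 'I_(size (tree v))) : occ i = tree_edge v (offset i).
Proof.
rewrite /occ (tnth_nth (tree_edge v (origin n))) /= (nth_map (origin n)) //.
by rewrite -(size_tree v).
Qed.

Lemma offset_inj v : injective (@offset v).
Proof.
move=> i j /eqP; rewrite nth_uniq ?enum_uniq -?(size_tree v) //.
by move=> /eqP/val_inj.
Qed.

Lemma exists_offset v w : w \in B -> exists i : 'I_(size (tree v)), offset i = w.
Proof.
rewrite -mem_enum => wB; have iw := wB; rewrite -index_mem -(size_tree v) in iw.
by exists (Ordinal iw); rewrite /offset nth_index.
Qed.

Lemma dst_tree v (i : 'I_(size (tree v))) : dst (occ i) = xorv v (offset i).
Proof. by rewrite occ_tree. Qed.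

(** The root is recovered as [xorv u' w], so only the entered vertex and the offset matter. *)
Lemma used_atP s u u' :
  used_at tree s u u' <->
  exists2 w, w \in B & u = flip u' (col u' w) /\ lab u' w = s.
Proof.
split=> [[v [i []]]|[w wB [-> <-]]].
  rewrite occ_tree /= => <- <- <-; exists (offset i) => //; exact: offset_mem.
have [i ow] := exists_offset (xorv u' w) wB.
by exists (xorv u' w), i; rewrite occ_tree ow /= xorvK.
Qed.

Lemma cg_time_tree T :
  (forall x w, w \in B -> lab x w <= T) -> cg_time tree <= T.
Proof.
move=> H; apply/bigmax_leqP => v _; rewrite /tg_time big_map big_seq.
apply: (big_ind (fun m => m <= T)) => // [a b aT bT|w].
  by rewrite geq_max aT.
by rewrite mem_enum => /H; apply.
Qed.

Hypothesis B0 : origin n \notin B.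

Hypothesis parent_before : forall x w, w \in B ->
  let c := col x w in flip w c != origin n ->
  flip w c \in B /\ lab (flip x c) (flip w c) < lab x w.

Hypothesis lab_gt0 : forall x w, w \in B -> 0 < lab x w.

(** Edges entering [x] and [x'] along a common direction have the same ends exactly when [x'] is [x]
    or its neighbour in that direction. *)
Hypothesis lab_conflict : forall x x' w w', w \in B -> w' \in B ->
  col x w = col x' w' -> x' = x \/ x' = flip x (col x w) ->
  lab x w = lab x' w' -> x = x' /\ w = w'.

Notation next v := (fun j k : 'I_(size (tree v)) => dst (occ j) == src (occ k)).

Lemma offset_neq0 v (i : 'I_(size (tree v))) : offset i != origin n.
Proof. by apply: contraNneq B0 => <-; apply: offset_mem. Qed.

(** The tail of [occ k] is the head of [occ j], hence not the root, and [parent_before] applies. *)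
Lemma next_lbl v (j k : 'I_(size (tree v))) :
  next v j k -> lbl (occ j) < lbl (occ k).
Proof.
rewrite !occ_tree /= flip_xorv => /eqP /(can_inj (xorKv v)) E.
have [|_] := @parent_before (xorv v (offset k)) _ (offset_mem k).
  by rewrite -E offset_neq0.
by rewrite -E flip_xorv -E.
Qed.

Lemma next_path v (i : 'I_(size (tree v))) p : path (next v) i p ->
  path (relpre (fun j => lbl (occ j)) ltn) i p.
Proof. by apply: sub_path => j k /next_lbl. Qed.

Lemma before_lbl v (i j : 'I_(size (tree v))) :
  before i j -> i = j \/ lbl (occ i) < lbl (occ j).
Proof.
case=> p /andP[/next_path H _] <-; case/lastP: p H => [|p k]; first by left.
rewrite last_rcons => H; right; move: H => /order_path_min.
move=> /(_ _)/allP; apply; last by rewrite mem_rcons mem_head.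
by move=> a b c /=; apply: ltn_trans.
Qed.

Lemma tree_task_graph v : is_task_graph (tree v).
Proof.
split=> [i|i|i j lt|i j eq]; rewrite ?occ_tree.
- exact: adjacent_flip.
- exact/lab_gt0/offset_mem.
- have nji : ~ before j i.
    by move=> /before_lbl[E|]; [rewrite E ltnn in lt|rewrite ltnNge ltnW].
  by have [] := classic (before i j); [left|right].
- have [->|nij] := eqVneq i j; [by left|right].
  by split=> /before_lbl[E|]; rewrite ?eq ?ltnn //; rewrite E eqxx in nij.
Qed.

Lemma tree_comm_graph : is_comm_graph tree.
Proof.
split; first exact: tree_task_graph.
move=> v v' i i'; rewrite !occ_tree /same_ends /=.
set x := xorv v _; set x' := xorv v' _; set c := col x _; set c' := col x' _.
move=> ends lab_eq.
have [|||] // := @lab_conflict x x' _ _ (offset_mem i) (offset_mem i').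
- rewrite -/c -/c'; move: ends => /orP[] /andP[/eqP E1 /eqP E2].
    move: E1; rewrite E2 => /ffunP/(_ c); rewrite !ffunE eqxx => /addbI.
    by move/esym/eqP.
  move: E2; rewrite -E1 => /ffunP/(_ c); rewrite !ffunE eqxx.
  by case: (c =P c') => // _; case: (v c (+) _).
- by move: ends => /orP[] /andP[/eqP E1 /eqP E2]; [left|right; rewrite E1].
move=> Ex Eo; have Ev : v = v'.
  by rewrite -(xorvK (offset i) v) -/x Ex Eo /x' xorvK.
split=> //; subst v'; congr (nat_of_ord _); exact: offset_inj.
Qed.

(** Induction on the time of entry, going back from the target to the root. *)
Lemma tree_path v w : w \in B -> exists (i : 'I_(size (tree v))) p,
  [/\ path (next v) i p, src (occ i) = v & offset (last i p) = w].
Proof.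
have [m] := ubnP (lab (xorv v w) w); elim: m w => // m IH w lt wB.
have [k kw] := exists_offset v wB.
have [E|neq] := eqVneq (flip w (col (xorv v w) w)) (origin n).
  exists k, [::]; split=> //.
  by rewrite occ_tree kw /= flip_xorv E xorv0.
have [vB lt'] := parent_before wB neq.
have [||i [p [pth si li]]] := IH (flip w (col (xorv v w) w)) => //.
  by rewrite -flip_xorv; apply: leq_trans lt' _.
exists i, (rcons p k); split=> //; last by rewrite last_rcons.
by rewrite rcons_path pth /= dst_tree li occ_tree kw /= flip_xorv.
Qed.

Lemma tree_dipath v u : xorv v u \in B -> has_dipath (tree v) v u.
Proof.
move=> /(tree_path v)[i [p [pth si li]]]; exists i, p.
split=> //; last by rewrite dst_tree li xorKv.
rewrite /dipath pth si andTb cons_uniq; apply/andP; split.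
  apply/mapP => -[j _]; rewrite dst_tree => E; have /eqP[] := offset_neq0 j.
  by rewrite -(xorKv v (offset j)) -E xorvv.
(* Distinct edges of the tree have distinct heads, and the edges of the path are distinct because
   their labels increase. *)
rewrite map_inj_uniq; last first.
  by move=> j k; rewrite !dst_tree => /(can_inj (xorKv v))/offset_inj.
apply: (@sorted_uniq _ (relpre (fun j => lbl (occ j)) ltn)).
- by move=> a b c /=; apply: ltn_trans.
- by move=> a /=; apply: ltnn.
exact: next_path pth.
Qed.

End Translates.

(** * Lower bound *)

Section Bounds.

Variable n : nat.
Notation d := n.+1.
Notation vert := (vertex n.+1).

Lemma card_vertex : #|{: vert}| = 2 ^ d.
Proof. by rewrite card_ffun card_bool card_ord. Qed.

Lemma N_diag : N d d = 2 ^ d - 1.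
Proof.
rewrite -card_ball -card_vertex subn1 -(cardsC1 (origin n)).
by apply: eq_card => w; rewrite ball_neq0 weight_le andbT !inE.
Qed.

(* Twice the number of pairs (source, target) is at most the number of triples
   (endpoint, direction, time): the edges entering the targets are distinct. *)
Lemma broadcast_time_ge l (C : vert -> tgraph d) :
  broadcast_within l C -> 2 * N d l <= d * cg_time C.
Proof.
move=> [[task conflict] paths]; set T := cg_time C.
pose entry v w : option 'I_(size (C v)) := [pick i | dst (occ i) == xorv v w].
pose dir (e : timed_edge d) := odflt ord0 [pick c | src e == flip (dst e) c].
have dirE v (i : 'I_(size (C v))) : src (occ i) = flip (dst (occ i)) (dir (occ i)).
  rewrite /dir; case: pickP => [c /eqP //|none].
  have [/(_ i) /adjacentP[c E] _ _ _] := task v.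
  by have := none c; rewrite E eqxx.
have lblT v (i : 'I_(size (C v))) : 0 < lbl (occ i) <= T.
  have [_ /(_ i) -> _ _] := task v; rewrite /=.
  apply: leq_trans (leq_bigmax v); rewrite /tg_time big_tnth.
  exact: (leq_bigmax (F := fun i => lbl (occ i))).
(* The boolean selects an endpoint of the entering edge. The [None] value is not taken on [D];
   labels being positive, the image avoids time [ord0], which leaves [T] times. *)
pose f (z : vert * (vert * bool)) : vert * 'I_d * 'I_T.+1 :=
  let: (v, (w, b)) := z in
  if entry v w is Some i then
    ((if b then dst (occ i) else src (occ i)), dir (occ i), inord (lbl (occ i)))
  else (v, ord0, ord0).
pose D := setX [set: vert] (setX (ball n l) [set: bool]).
have entryP v w : w \in ball n l ->
    exists2 i, entry v w = Some i & dst (occ i) = xorv v w.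
  rewrite inE => wl; rewrite /entry; case: pickP => [i /eqP|none]; first by exists i.
  have [|i [p [_ _ E]]] := paths v (xorv v w); first by rewrite hamming_xorv xorKv.
  by have := none (last i p); rewrite E eqxx.
have finj : {in D &, injective f}.
  move=> [v [w b]] [v' [w' b']]; rewrite !in_setX !in_setT !andbT /= => wB w'B.
  have [i -> di] := entryP v w wB; have [i' -> di'] := entryP v' w' w'B.
  case=> Ey Ec /(congr1 val) /=; rewrite !inordK ?ltnS; last 2 first.
    by have /andP[] := lblT _ i'.
    by have /andP[] := lblT _ i.
  move=> El.
  have ends : same_ends (occ i) (occ i').
    rewrite /same_ends; case: b b' Ey => -[] Ey.
    - by rewrite (dirE _ i) (dirE _ i') -Ec -Ey !eqxx.
    - by rewrite (dirE _ i) Ey Ec (dirE _ i') flipK !eqxx orbT.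
    - by rewrite (dirE _ i') -Ec -Ey (dirE _ i) flipK !eqxx orbT.
    - rewrite Ey -(flipK (dir (occ i)) (dst (occ i))) -dirE Ey Ec.
      by rewrite (dirE _ i') flipK !eqxx.
  have [Ev Ei] := conflict _ _ _ _ ends El; subst v'.
  have {Ei} Ei : i = i' by apply: val_inj.
  subst i'; have -> : w = w' by apply: (can_inj (xorKv v)); rewrite -di -di'.
  suff -> : b = b' by [].
  have loop : dst (occ i) <> src (occ i).
    rewrite dirE => /ffunP/(_ (dir (occ i))); rewrite ffunE eqxx.
    by case: (dst _ _).
  by case: b b' Ey {ends} => -[] // Ey; case: loop.
have fD : f @: D \subset setX [set: vert * 'I_d] [set~ ord0].
  apply/subsetP => _ /imsetP[[v [w b]] + ->]; rewrite in_setX in_setT in_setX in_setT andbT /= => wB.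
  have [i -> _] := entryP v w wB; rewrite !inE /=.
  apply/eqP => /(congr1 val) /=; have /andP[l0 lT] := lblT _ i.
  by rewrite inordK ?ltnS // => E; rewrite E in l0.
have := subset_leq_card fD; rewrite (card_in_imset finj) !cardsX !cardsT.
rewrite cardsC1 card_prod !card_ord card_bool card_ball card_vertex /=.
by rewrite -mulnA leq_pmul2l ?expn_gt0 // mulnC.
Qed.
End Bounds.

(** * Oriented broadcast *)

Section Construction.

Variable n : nat.
Notation d := n.+1.
Notation vert := (vertex n.+1).

(* The least [T] with [2 (q d + r) <= d T], for [r < d]. *)
Definition steps q r := 2 * q + (if r == 0 then 0 else if 2 * r <= d then 1 else 2).

Lemma steps_minimal q r T : r < d -> 2 * (q * d + r) <= d * T -> steps q r <= T.
Proof.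
move=> rd le; rewrite /steps; case: eqP => [r0|r0].
  by rewrite addn0 -(@leq_pmul2l d) // (leq_trans _ le) // r0; lia.
case: (leqP (2 * r) d) => dr; rewrite leqNgt; apply/negP => lt.
  have : d * T <= d * (2 * q) by rewrite leq_mul2l; lia.
  by lia.
have : d * T <= d * (2 * q + 1) by rewrite leq_mul2l; lia.
by lia.
Qed.

Lemma steps_ge q r : r < d -> 2 * (q * d + r) <= d * steps q r.
Proof. by move=> rd; rewrite /steps; case: eqP => [|_]; [|case: (leqP (2 * r) d)]; lia. Qed.

Lemma modn_window m p p' : m <= p < m + d -> m <= p' < m + d ->
  p = p' %[mod d] -> p = p'.
Proof.
move=> /andP[mp pm] /andP[mp' pm'] /eqP.
rewrite -(subnKC mp) -(subnKC mp') eqn_modDl !modn_small; lia.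
Qed.

Section Schedule.

Variables (l q r : nat).
Hypothesis l1 : 1 <= l <= d.
Hypothesis NE : N d l = q * d + r.
Hypothesis rd : r < d.

(** The case in which the incomplete block is given one step instead of two. *)
Definition half := (0 < r) && (2 * r <= d).

(* The vertices of positions at least [cut] are reached during the last step,
   numbered [2 q + 1]. *)
Definition cut := if half then q * d else q * d + r.

Lemma steps_half : half -> steps q r = 2 * q + 1.
Proof. by rewrite /half /steps lt0n; case: eqP => //= _ ->. Qed.

Lemma exists_cut_schedule : exists h a, schedule (ball n l) h /\
  {in ball n l, forall w, cut <= h w -> half /\
    forall c, c = inZp (a + h w) \/ c = inZp (a + r + h w) ->
    flip w c != origin n -> flip w c \in ball n l /\ h (flip w c) < cut}.
Proof.
rewrite /cut; case Eh: half.
  have /andP[r0 r2] := Eh.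
  (* For [l = 1] the ball has [d] elements, so [r] would be 0. *)
  have l2 : 2 <= l <= d.
    move: l1 NE rd r0; case: (l) => [|[|l']] //; rewrite /N big_nat1 bin1.
    move=> _ E lt r0; exfalso; case: q E => [|q'] E; lia.
  have [h [a [sch H]]] := exists_ball_schedule_last l2 r0 r2.
  exists h, a; split=> // w wB; move: (H w wB); rewrite card_ball NE addnK => H' hw.
  by split=> //; apply: H'.
have [h sch] := exists_ball_schedule n l.
exists h, 0; split=> // w wB; rewrite -NE -card_ball leqNgt.
by case: sch => _ /(_ w wB) ->.
Qed.

(* The edge [uv] is used, in the direction given by the orientation, at the odd
   step [s]. *)
Definition shared (h : vert -> nat) s (u v : vert) :=
  exists2 w, w \in ball n l & [/\ h w < cut, s = 2 * (h w %/ d) + 1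
    & u = flip v (inZp (h w))].

Lemma sharedC h s u v : shared h s u v -> shared h s v u.
Proof. by case=> w wB [hw sE ->]; exists w => //; split=> //; rewrite flipK. Qed.

Lemma shared_adjacent h s u v : shared h s u v -> adjacent u v.
Proof. by case=> w wB [_ _ ->]; apply: adjacent_flip. Qed.

(** The schedule [h] is fixed before [o], so all orientations share the same undirected edges at the
    odd steps. *)
Lemma exists_oriented_broadcast : exists h, forall o, @is_orientation d o ->
  exists C : vert -> tgraph d, [/\ broadcast_within l C, cg_time C <= steps q r
  & forall s u v, odd s -> s < steps q r ->
      (used_at C s u v <-> shared h s u v /\ o s u v) /\
      (shared h s u v -> ~~ o s u v -> used_at C s.+1 u v)].
Proof.
have [h [a [[hinj hN hpar] last]]] := exists_cut_schedule.
exists h => o oriented.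
pose c0 w : 'I_d := inZp (a + h w).
pose c1 w : 'I_d := inZp (a + r + h w).
(* At the last step the squares of directions [c0 w], [c1 w] are oriented
   cyclically, so that each vertex is entered along one of them. *)
pose col (x w : vert) := if h w < cut then inZp (h w)
  else if x (c0 w) (+) x (c1 w) then c1 w else c0 w.
(* In block [b], the edge entering [x] gets step [2b + 1] if [o] directs it towards [x], and
   [2b + 2] otherwise. *)
pose lab (x w : vert) := if h w < cut then
    2 * (h w %/ d) + 1 + ~~ o (2 * (h w %/ d) + 1) (flip x (col x w)) x
  else 2 * q + 1.
have colE x w : ~ h w < cut -> col x w = c0 w \/ col x w = c1 w.
  by rewrite /col => /negP/negbTE ->; case: ifP; [right|left].
have blk w : half -> h w < cut -> h w %/ d < q.
  by rewrite /cut => -> lt; rewrite ltn_divLR.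
have lab_lt x w : h w < cut -> lab x w <= 2 * (h w %/ d) + 2.
  by rewrite /lab => ->; case: (o _ _ _) => /=; lia.
have lab_gt x w : h w < cut -> 2 * (h w %/ d) < lab x w.
  by rewrite /lab => ->; lia.
have lab_last x w : ~ h w < cut -> lab x w = 2 * q + 1.
  by rewrite /lab => /negP/negbTE ->.
have late w : w \in ball n l -> ~ h w < cut ->
    [/\ half, cut = q * d, q * d <= h w & h w < q * d + r].
  move=> wB /negP; rewrite -leqNgt => hw; have [hf _] := last w wB hw.
  have := hN w wB; rewrite card_ball NE; move: hw; rewrite /cut hf => hw hN'.
  by split.
have parent x w : w \in ball n l -> let c := col x w in flip w c != origin n ->
    flip w c \in ball n l /\ lab (flip x c) (flip w c) < lab x w.
  move=> wB; have [hw|/negP hw] := boolP (h w < cut).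
    rewrite /= {1 2 4}/col hw => /(hpar w wB)[vB lt]; split=> //.
    have hv : h (flip w (inZp (h w))) < cut.
      apply: leq_trans hw; rewrite ltnS leqNgt; apply/negP => lt'.
      by have := leq_div2r d (ltnW lt'); rewrite leqNgt lt.
    have le := lab_lt (flip x (inZp (h w))) _ hv; have := lab_gt x w hw.
    by rewrite /col hw; move: le lt; clear; lia.
  have [hf _ _ _] := late w wB hw.
  have cw : cut <= h w by rewrite leqNgt; apply/negP.
  move=> /= v0; have [_ Hc] := last w wB cw.
  have [vB hv] := Hc _ (colE x w hw) v0; split=> //.
  have := lab_lt (flip x (col x w)) _ hv; have := blk _ hf hv.
  by rewrite (lab_last x w hw); clear; lia.
have c01 w : half -> c0 w != c1 w.
  move=> /andP[r0 _]; rewrite eq_inZp [a + r + _]addnAC -{1}[a + h w]addn0.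
  by rewrite eqn_modDl mod0n modn_small // eq_sym -lt0n.
have same_pos x x' w w' : w \in ball n l -> w' \in ball n l ->
    col x w = col x' w' -> lab x w = lab x' w' -> h w = h w'.
  move=> wB w'B.
  have mixed y y' u u' : u' \in ball n l -> h u < cut -> ~ h u' < cut ->
      lab y u <> lab y' u'.
    move=> u'B hu hu'; have [hf _ _ _] := late _ u'B hu'.
    have := lab_lt y u hu; have := blk u hf hu; rewrite (lab_last y' u' hu').
    by move: (lab y u) (h u %/ d); clear; lia.
  have [hw|/negP hw] := boolP (h w < cut); have [hw'|/negP hw'] := boolP (h w' < cut).
  - rewrite /lab hw hw' {1}/col {1}/col hw hw' => Ec El.
    rewrite (divn_eq (h w) d) (divn_eq (h w') d); congr (_ * d + _); last first.
      by apply/eqP; rewrite -eq_inZp Ec.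
    by move: El; case: (o _ _ _); case: (o _ _ _); move: (_ %/ d) (_ %/ d) => /= b b'; clear; lia.
  - by move=> _ /mixed => /(_ w'B hw hw').
  - by move=> _ /esym /mixed => /(_ wB hw' hw).
  (* All values [a + h w] and [a + r + h w] lie in a window of length [2 r <= d] from [a + q * d],
     the former in its first half and the latter in its second. *)
  have [/andP[_ r2] _ lo up] := late w wB hw.
  have [_ _ lo' up'] := late w' w'B hw'.
  have win := @modn_window (a + q * d).
  have [|] := colE x w hw => ->; have [|] := colE x' w' hw' => -> /eqP;
    rewrite eq_inZp => /eqP E _; have := fun b b' => win _ _ b b' E;
    move: lo up lo' up' r2; clear; lia.
have conflict x x' w w' : w \in ball n l -> w' \in ball n l ->
    col x w = col x' w' -> x' = x \/ x' = flip x (col x w) ->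
    lab x w = lab x' w' -> x = x' /\ w = w'.
  move=> wB w'B Ec Ex El.
  have Ew : w = w' by apply: hinj => //; apply: same_pos El.
  subst w'; split=> //; case: Ex => // Ex; exfalso.
  have [hw|/negP hw] := boolP (h w < cut).
    move: El; rewrite /lab hw -Ec Ex flipK.
    by rewrite (oriented _ _ _ (adjacent_flip x (col x w))); case: (o _ _ _) => /=; lia.
  (* Crossing [c0 w] or [c1 w] changes the parity that selects between them, so the two ends are
     entered along different directions. *)
  have [hf _ _ _] := late w wB hw.
  move: Ec Ex; rewrite /col (introF idP hw).
  have ne := negbTE (c01 w hf); have ne' := ne; rewrite eq_sym in ne'.
  case: ifP => par Ec' Ex; move: Ec'; rewrite Ex !ffunE !eqxx ?ne ?ne' addbF.
    by rewrite addbA par => /eqP; rewrite ne'.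
  by rewrite addbAC par => /eqP; rewrite ne.
pose C := tree (ball n l) col lab.
exists C; split.
- split=> [|u v uv].
    apply: (tree_comm_graph (origin_notin_ball n l) parent _ conflict) => x w _.
    by rewrite /lab; case: ifP => _; rewrite ?addn1 // addnAC addn1.
  by apply: (tree_dipath (origin_notin_ball n l) parent); rewrite inE -hamming_xorv.
- apply: cg_time_tree => x w wB; have [hw|/negP hw] := boolP (h w < cut); last first.
    by have [hf _ _ _] := late w wB hw; rewrite lab_last // steps_half.
  apply: leq_trans (lab_lt x w hw) _; move: hw; rewrite /cut /steps /half.
  case: eqP => [->|/eqP r0]; rewrite ?ltnn /= ?addn0 ?mul0n.
    by rewrite -ltn_divLR //; move: (_ %/ d); clear; lia.
  rewrite lt0n r0 /=; case: ifP => _ hw.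
    by move: hw; rewrite -ltn_divLR //; move: (_ %/ d); clear; lia.
  have : h w < q.+1 * d by rewrite mulSn; move: hw rd; clear; lia.
  by rewrite -ltn_divLR //; move: (_ %/ d); clear; lia.
move=> s u v sodd slt; split.
  split=> [/used_atP[w wB [uE labE]]|[[w wB [hw sE uE]] ouv]].
    have [hw|/negP hw] := boolP (h w < cut); last first.
      (* A late edge is used at the final step [2 q + 1], excluded by [s < steps q r]. *)
      have [hf _ _ _] := late w wB hw; move: slt.
      by rewrite -labE lab_last // steps_half // ltnn.
    move: uE labE; rewrite /lab /col hw => uE; rewrite -uE => labE.
    have sE : s = 2 * (h w %/ d) + 1.
      by move: sodd labE; case: (o _ _ _); move: (_ %/ d) => /= b; clear; lia.
    split; first by exists w.
    by apply/negPn/negP => nouv; move: labE; rewrite -sE nouv addn1 => /esym/n_Sn.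
  apply/used_atP; exists w => //.
  by rewrite /lab /col hw -uE -sE ouv addn0.
case=> w wB [hw sE uE] nouv; apply/used_atP; exists w => //.
by rewrite /lab /col hw -uE -sE nouv addn1.
Qed.

End Schedule.
End Construction.

(** * Optimality *)

Import Order.TTheory GRing.Theory Num.Theory.

Lemma ceil_natr_div (m n k : nat) :
  (Num.ceil (m%:R / n.+1%:R : rat)%R <= Posz k)%R = (m <= n.+1 * k).
Proof.
rewrite ceil_le_int ler_pdivrMr ?ltr0n // -pmulrn -natrM ler_nat mulnC.
by [].
Qed.

Lemma ceil_natr_div_eq (m n k : nat) : m <= n.+1 * k ->
  (forall j, m <= n.+1 * j -> k <= j) ->
  Num.ceil (m%:R / n.+1%:R : rat)%R = Posz k.
Proof.
move=> mk kmin; apply/eqP; rewrite eq_le ceil_natr_div mk /=.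
have x0 : (0 <= Num.ceil (m%:R / n.+1%:R : rat))%R.
  by rewrite -(ceil0 rat); apply: le_ceil; rewrite divr_ge0 // ler0n.
case E : (Num.ceil _) x0 => [j|j] // _; rewrite lez_nat; apply: kmin.
by rewrite -ceil_natr_div E lexx.
Qed.

Section Optimal.

Variables (n l : nat).
Notation d := n.+1.
Hypothesis l1 : 1 <= l <= d.

Notation T := (steps n (N d l %/ d) (N d l %% d)).

Lemma broadcast_steps_le C : @broadcast_within d l C -> T <= cg_time C.
Proof.
move=> /broadcast_time_ge; rewrite {1}(divn_eq (N d l) d); apply: steps_minimal.
exact: ltn_pmod.
Qed.

(** Any orientation would do here; it produces the reference graph that is then redirected. *)
Definition rank_orientation (s : nat) (u v : vertex d) : bool :=
  enum_rank u < enum_rank v.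

Lemma rank_orientationP : is_orientation rank_orientation.
Proof.
move=> s u v uv; rewrite /rank_orientation -leqNgt ltn_neqAle.
case: eqP => // /val_inj/enum_rank_inj E; move: uv; rewrite E.
by move=> /adjacentP[c /ffunP/(_ c)]; rewrite ffunE eqxx; case: (v c).
Qed.

Lemma exists_oriented_optimal : exists h, forall o, @is_orientation d o ->
  exists C, [/\ optimal (@broadcast_within d l) C, cg_time C = T
  & forall s u v, paired_step C s ->
      (used_at C s u v <-> shared l (N d l %/ d) (N d l %% d) h s u v /\ o s u v) /\
      (used_at C s u v -> used_at C s.+1 v u)].
Proof.
have [h H] := exists_oriented_broadcast l1 (divn_eq (N d l) d) (ltn_pmod _ (isT : 0 < d)).
exists h => o oriented; have [C [bC tC uC]] := H o oriented.
have ET : cg_time C = T by apply/eqP; rewrite eqn_leq tC broadcast_steps_le.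
exists C; split=> //.
  by split=> // C' /broadcast_steps_le; rewrite ET.
move=> s u v /andP[sodd]; rewrite ET => slt; have [uE uE'] := uC s u v sodd slt.
split=> //; rewrite uE => -[sh ouv].
have [_] := uC s v u sodd slt; apply; first exact: sharedC.
by rewrite (oriented _ _ _ (shared_adjacent (sharedC sh))) ouv.
Qed.

Lemma min_time_broadcast :
  is_min_time (@broadcast_within d l) (Num.ceil ((2 * N d l)%:R / d%:R : rat)%R).
Proof.
have Tge := steps_ge (N d l %/ d) (ltn_pmod (N d l) (isT : 0 < d)).
rewrite -divn_eq in Tge.
rewrite (ceil_natr_div_eq Tge); last first.
  move=> j; rewrite {1}(divn_eq (N d l) d); apply: steps_minimal.
  exact: ltn_pmod.
have [h H] := exists_oriented_optimal.
have [C [[bC _] ET _]] := H _ rank_orientationP.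
split; first by exists C; rewrite ET.
by move=> C' /broadcast_steps_le; rewrite lez_nat.
Qed.

Lemma broadcast_arbitrarily_directable :
  arbitrarily_directable (@broadcast_within d l).
Proof.
have [h H] := exists_oriented_optimal.
have [C [oC ET uC]] := H _ rank_orientationP.
exists C; split=> // [s u v ps us|o oriented].
  by have [_] := uC s u v ps; apply.
have [C' [oC' ET' uC']] := H o oriented.
exists C'; split=> // [s u v ps us|s u v ps]; first by have [_] := uC' s u v ps; apply.
(* Both graphs attain the optimal time, so they have the same paired steps. *)
have ps' : paired_step C' s by rewrite /paired_step ET' -ET.
have [-> _] := uC' s u v ps'; have [-> _] := uC s u v ps; have [-> _] := uC s v u ps.
split=> [[sh ouv]|[[[sh _]|[/sharedC sh _]] ouv]] //; split=> //.
rewrite (rank_orientationP s (shared_adjacent sh)).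
by case: (rank_orientation s v u); [right; split=> //; apply: sharedC|left].
Qed.

End Optimal.

Theorem theorem6p3 (d : nat) (hd : 1 <= d) :
  is_min_time (@universal_broadcast d)
    (Num.ceil ((2 * (2 ^ d - 1))%:R / d%:R : rat)%R) /\
  (forall l : nat, 1 <= l <= d ->
     is_min_time (@broadcast_within d l)
       (Num.ceil ((2 * N d l)%:R / d%:R : rat)%R) /\
     arbitrarily_directable (@broadcast_within d l)).
Proof.
case: d hd => [//|n] _; split=> [|l l1].
  by rewrite -N_diag; apply: min_time_broadcast; rewrite leqnn.
by split; [apply: min_time_broadcast|apply: broadcast_arbitrarily_directable].
Qed.
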